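(* Let $p,q\in(0,1)$ with $p\leq q$. Then for any hypergraph $H$, $b_{L,p}(H)\leq b_{L,q}(H)$ and $b_p(H)\leq b_q(H)$.
   Context: A hypergraph $H=(V(H),E(H))$ has a finite nonempty vertex set and a finite collection $E(H)$ of subsets of $V(H)$ called edges (parallel edges allowed). For a proportion $p\in(0,1)$, the proportion-based propagation rule is: if at the end of a round at least $\lceil p|e|\rceil$ vertices of an edge $e$ are on fire, then in the next round all vertices of $e$ catch fire; burned vertices stay burned. Burning game: let $F_0=\emptyset$ and $F_r$ be the set of burned vertices at the end of round $r$. In each round $r\geq 1$, simultaneously, vertices catch fire by propagation from $F_{r-1}$ (no propagation in round 1), and a player chooses a vertex $u_r\notin F_{r-1}$ (a source) and sets it on fire. A burning sequence is a sequence $(u_1,\ldots,u_k)$ of such sources after which every vertex is on fire at the end of round $k$; $b_p(H)$ is the minimum length of a burning sequence. Lazy game: $S\subseteq V(H)$ is a lazy burning set if, setting all of $S$ on fire at once and then repeatedly applying the propagation rule, every vertex eventually catches fire; $b_{L,p}(H)$ is the minimum size of a lazy burning set. *)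

(* Defs.v *)
From HB Require Import structures.
From mathcomp Require Import all_boot all_order all_algebra.
From mathcomp Require Import boolp reals.

Set Implicit Arguments.
Unset Strict Implicit.
Unset Printing Implicit Defensive.

Import Order.TTheory GRing.Theory Num.Theory.
Local Open Scope ring_scope.

(* Edges are indexed, so that distinct indices may carry the same vertex set
   (parallel edges); empty edges are allowed. *)
Record hypergraph := Hypergraph {
  vertex : finType;
  vertex_gt0 : (0 < #|vertex|)%N;
  edge_index : finType;
  edge : edge_index -> {set vertex}
}.

Section Burning.
Context {R : realType}.
Implicit Types (H : hypergraph) (p : R).

Definition ignites H p (F : {set vertex H}) (e : {set vertex H}) : bool :=
  Num.ceil (p * #|e|%:R) <= #|e :&: F|%:Z.

Definition propagate H p (F : {set vertex H}) : {set vertex H} :=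
  F :|: \bigcup_(i : edge_index H | ignites p F (edge i)) edge i.

(* [burned p [:: u_1; ...; u_r]] is F_r. For 0 < p nothing propagates in
   round 1: see [propagate0]. *)
Definition burned H p (us : seq (vertex H)) : {set vertex H} :=
  foldl (fun F u => u |: propagate p F) set0 us.

(* The indices of [u] start at 0: [tnth u r] is the source of round r + 1 and
   [burned p (take r u)] is the burned set at the end of round r. *)
Definition burning_sequence H p k (u : k.-tuple (vertex H)) : Prop :=
  (forall r : 'I_k, tnth u r \notin burned p (take r u)) /\
  burned p u = [set: vertex H].

Definition lazy_burning_set H p (S : {set vertex H}) : Prop :=
  exists n, iter n (propagate p) S = [set: vertex H].

Lemma propagate0 H p : 0 < p -> propagate p set0 = set0 :> {set vertex H}.
Proof.
move=> p0; rewrite /propagate set0U; apply: big1 => i.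
rewrite /ignites setI0 cards0 ceil_le_int pmulr_rle0 // lern0 cards_eq0.
by move/eqP.
Qed.

Lemma burning_sequence_exists H p :
  exists k, `[< exists u : k.-tuple (vertex H), burning_sequence p u >].
Proof.
pose legal (s : seq (vertex H)) :=
  forall s1 x s2, s = s1 ++ x :: s2 -> x \notin burned p s1.
have ext n : forall s, legal s -> (#|~: burned p s| <= n)%N ->
    exists s', legal s' /\ burned p s' = setT.
  elim: n => [|n IHn] s Ls.
    rewrite leqn0 cards_eq0 => /eqP F; exists s; split=> //.
    by rewrite -[LHS]setCK F setC0.
  have [/eqP|[x]] := set_0Vmem (~: burned p s).
    by move=> /eqP F _; exists s; split=> //; rewrite -[LHS]setCK F setC0.
  rewrite inE => xF leF; apply: (IHn (rcons s x)).
    move=> s1 y s2; case/lastP: s2 => [|s2 z].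
      by rewrite cats1 => /rcons_inj[<- <-].
    by rewrite -rcons_cons -rcons_cat => /rcons_inj[+ _]; apply: Ls.
  rewrite -ltnS; apply: leq_trans leF; apply: proper_card.
  rewrite properE; apply/andP; split.
    rewrite setCS /burned foldl_rcons; apply/subsetP => y yF.
    by rewrite !inE [X in _ || (X || _)]yF orbT.
  apply/subsetPn; exists x; first by rewrite inE.
  by rewrite /burned foldl_rcons !inE eqxx.
have [|s [Ls Fs]] := ext _ [::] _ (leqnn _); first by case.
exists (size s); apply/asboolP; exists (in_tuple s); split=> // r.
apply: (Ls _ _ (drop r.+1 s)).
have x0 : vertex H by exact: (tnth (in_tuple s) r).
by rewrite (tnth_nth x0) /= -drop_nth ?cat_take_drop.
Qed.

Lemma lazy_burning_set_exists H p :
  exists k, `[< exists S : {set vertex H}, lazy_burning_set p S /\ #|S| = k >].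
Proof.
by exists #|[set: vertex H]|; apply/asboolP; exists setT; split=> //; exists 0%N.
Qed.

Definition burning_number H p : nat := ex_minn (burning_sequence_exists H p).

Definition lazy_burning_number H p : nat :=
  ex_minn (lazy_burning_set_exists H p).

End Burning.

(* Main.v *)
Require Import Defs.
From mathcomp Require Import all_boot all_order all_algebra.
From mathcomp Require Import boolp reals.

(** Lowering the proportion or enlarging the burned set only helps the fire.
    So a lazy burning set for [q] is one for [p], and in the game with
    proportion [p] the player can copy a burning sequence for [q]: if the
    prescribed source is already burned, any unburned vertex serves instead,
    and if there is none the game is over early. *)

Local Open Scope ring_scope.

Import Order.TTheory GRing.Theory Num.Theory.

Section Monotonicity.
Context {R : realType} (H : hypergraph).
Implicit Types (p q : R) (F G : {set vertex H}) (us s : seq (vertex H)).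

(** The threshold is monotone in the proportion and the count of burned vertices in the set. Both
    vary at once because the two fires already differ after one round. *)
Lemma ignites_mono p q F G (e : {set vertex H}) :
  p <= q -> F \subset G -> ignites q F e -> ignites p G e.
Proof.
move=> pq FG; rewrite /ignites => qF.
apply: (le_trans (y := Num.ceil (q * #|e|%:R))).
  by apply: le_ceil; apply: ler_wpM2r.
by apply: le_trans qF _; rewrite lez_nat subset_leq_card // setIS.
Qed.

Lemma propagate_mono p q F G :
  p <= q -> F \subset G -> propagate q F \subset propagate p G.
Proof.
move=> pq FG; apply: setUSS => //; apply/bigcupsP => i qi.
by apply: bigcup_sup; apply: ignites_mono qi.
Qed.

Lemma iter_propagate_mono p q F n :
  p <= q -> iter n (propagate q) F \subset iter n (propagate p) F.
Proof. by move=> pq; elim: n => //= n; apply: propagate_mono. Qed.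

Lemma lazy_burning_set_mono p q F :
  p <= q -> lazy_burning_set q F -> lazy_burning_set p F.
Proof.
move=> pq [n qF]; exists n; apply/eqP.
by rewrite -subTset -qF iter_propagate_mono.
Qed.

(** The legality half of [burning_sequence], put on lists so that a play can be built by appending
    sources. *)
Definition unburned_sources p s : Prop :=
  forall x0 r, (r < size s)%N -> nth x0 s r \notin burned p (take r s).

Lemma unburned_sources_rcons p s x :
  unburned_sources p s -> x \notin burned p s ->
  unburned_sources p (rcons s x).
Proof.
move=> us xs x0 r; rewrite size_rcons ltnS leq_eqVlt nth_rcons -cats1.
case/predU1P => [->|rs]; first by rewrite ltnn eqxx take_size_cat.
by rewrite rs takel_cat ?us // ltnW.
Qed.

Lemma burned_rcons p s x : burned p (rcons s x) = x |: propagate p (burned p s).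
Proof. by rewrite /burned foldl_rcons. Qed.

Lemma unburned_sources_dominate p q us : p <= q ->
  exists s, [/\ unburned_sources p s, (size s <= size us)%N &
                burned q us \subset burned p s].
Proof.
move=> pq; elim/last_ind: us => [|us u [s [ps le_s sub_s]]].
  by exists [::]; split.
(* A legal move [x] keeps the domination as soon as [u] burns too, either as [x] itself or from
   before. *)
have extend x : x \notin burned p s -> u \in x |: burned p s ->
    exists s, [/\ unburned_sources p s, (size s <= size (rcons us u))%N &
                  burned q (rcons us u) \subset burned p s].
  move=> xs ux; exists (rcons s x); split.
  - exact: unburned_sources_rcons.
  - by rewrite !size_rcons.
  rewrite !burned_rcons subUset sub1set; apply/andP; split.
    by apply: (subsetP _ _ ux); rewrite setUS // subsetUl.
  by apply: subset_trans (subsetUr _ _); apply: propagate_mono.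
have [us_u|] := boolP (u \in burned p s); last first.
  by move=> /extend; apply; rewrite setU11.
(* With [u] already burned, a round must still be played to match the propagation for [q]. *)
have [s0|[x]] := set_0Vmem (~: burned p s); last first.
  by rewrite inE => /extend; apply; rewrite setU1r.
(* Everything is burned, so [s] stops here and may end up shorter than the copied list. *)
exists s; split=> //; first by rewrite size_rcons ltnW.
by rewrite -[burned p s]setCK s0 setC0 subsetT.
Qed.

Lemma unburned_sources_tuple p s :
  unburned_sources p s -> burned p s = [set: vertex H] ->
  burning_sequence p (in_tuple s).
Proof.
move=> us sT; split=> // r.
by rewrite (tnth_nth (tnth (in_tuple s) r)) us.
Qed.

End Monotonicity.

Theorem theorem2p12 (R : realType) (p q : R)
    (hp : 0 < p < 1) (hq : 0 < q < 1) (hpq : p <= q) (H : hypergraph) :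
  (lazy_burning_number H p <= lazy_burning_number H q)%N /\
  (burning_number H p <= burning_number H q)%N.
Proof.
split.
  rewrite /lazy_burning_number.
  case: ex_minnP => m _ min_m; case: ex_minnP => n /asboolP[S [qS Sn]] _.
  apply: min_m; apply/asboolP; exists S; split=> //.
  exact: lazy_burning_set_mono qS.
rewrite /burning_number.
case: ex_minnP => m _ min_m; case: ex_minnP => n /asboolP[u [_ uT]] _.
have [s [ps le_s sub_s]] := unburned_sources_dominate _ _ _ u hpq.
(* Minimality of [m] is used at the length of [s], which is at most [n]. *)
rewrite -(size_tuple u); apply: leq_trans le_s; apply: min_m; apply/asboolP.
exists (in_tuple s); apply: unburned_sources_tuple => //.
by apply/eqP; rewrite -subTset -uT.
Qed.
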